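(* Let $\Pi_q$ be a projective plane of order $q$, let $1\leq t<q$, and let $\mathcal{S}$ be a $t$-semiarc in $\Pi_q$. Suppose $\ell_1,\ell_2$ are two distinct lines, and let $n=|\ell_1\setminus(\mathcal{S}\cup\ell_2)|$ and $m=|\ell_2\setminus(\mathcal{S}\cup\ell_1)|$. (1) If $\ell_1\cap\ell_2\notin\mathcal{S}$, $t>1$ and $q>\min\{n,m\}+2nm/(t-1)$, then $n=m=t$ and $\mathcal{S}$ is of $V_t^\circ$ type. (2) If $\ell_1\cap\ell_2\in\mathcal{S}$ and $q>\min\{n,m\}+nm/t$, then $n=m=t$, $t=(q-1)/2$, $|\mathcal{S}|=3(q+1)/2$, and $\mathcal{S}$ is of $V_t^\bullet$ type.
   Context: A non-empty point set $\mathcal{S}$ of $\Pi_q$ is a $t$-semiarc if for every point $P\in\mathcal{S}$ there are exactly $t$ lines $\ell$ with $\ell\cap\mathcal{S}=\{P\}$ (tangents at $P$). For two distinct lines $\ell_1,\ell_2$, a $V_t$-configuration is a set obtained from the symmetric difference $\ell_1\triangle\ell_2$ by removing $t$ further points from each of $\ell_1\setminus\ell_2$ and $\ell_2\setminus\ell_1$. $\mathcal{S}$ is of $V_t^\circ$ type (resp. $V_t^\bullet$ type) if there are two distinct lines $\ell_1,\ell_2$ such that $(\ell_1\triangle\ell_2)\cap\mathcal{S}$ is a $V_t$-configuration with respect to $\ell_1,\ell_2$ and $\ell_1\cap\ell_2\notin\mathcal{S}$ (resp. $\ell_1\cap\ell_2\in\mathcal{S}$). *)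

(* Defs.v *)
From mathcomp Require Import all_boot all_order all_algebra.

Set Implicit Arguments.
Unset Strict Implicit.
Unset Printing Implicit Defensive.

(* A finite projective plane is a finite point type [T] together with the set
   [lines] of its lines, each line being identified with its set of points. *)

Definition projective_plane (T : finType) (lines : {set {set T}}) : Prop :=
  [/\ forall P Q : T, P != Q ->
        exists! l : {set T}, [/\ l \in lines, P \in l & Q \in l],
      forall l1 l2 : {set T}, l1 \in lines -> l2 \in lines -> l1 != l2 ->
        exists! P : T, P \in l1 /\ P \in l2
    & exists2 F : {set T}, #|F| = 4 &
        forall l : {set T}, l \in lines -> #|l :&: F| <= 2].

Definition projective_plane_of_order (q : nat) (T : finType)
    (lines : {set {set T}}) : Prop :=
  projective_plane lines /\ forall l, l \in lines -> #|l| = q.+1.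

Definition tangents (T : finType) (lines : {set {set T}}) (S : {set T})
    (P : T) : {set {set T}} :=
  [set l in lines | l :&: S == [set P]].

Definition semiarc (T : finType) (lines : {set {set T}}) (t : nat)
    (S : {set T}) : Prop :=
  S != set0 /\ forall P, P \in S -> #|tangents lines S P| = t.

Definition symdiff (T : finType) (A B : {set T}) : {set T} :=
  (A :\: B) :|: (B :\: A).

Definition V_configuration (T : finType) (t : nat) (l1 l2 V : {set T}) : Prop :=
  exists X1 X2 : {set T},
    [/\ X1 \subset l1 :\: l2, #|X1| = t,
        X2 \subset l2 :\: l1, #|X2| = t
      & V = symdiff l1 l2 :\: (X1 :|: X2)].

Definition V_circ_type (T : finType) (lines : {set {set T}}) (t : nat)
    (S : {set T}) : Prop :=
  exists l1 l2 : {set T},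
    [/\ l1 \in lines, l2 \in lines, l1 != l2,
        V_configuration t l1 l2 (symdiff l1 l2 :&: S)
      & exists2 P : T, l1 :&: l2 = [set P] & P \notin S].

Definition V_bullet_type (T : finType) (lines : {set {set T}}) (t : nat)
    (S : {set T}) : Prop :=
  exists l1 l2 : {set T},
    [/\ l1 \in lines, l2 \in lines, l1 != l2,
        V_configuration t l1 l2 (symdiff l1 l2 :&: S)
      & exists2 P : T, l1 :&: l2 = [set P] & P \in S].

(* Main.v *)
(* Let R = S \ (l1 U l2), let N and M be the sets of n and m points missing from
   S on l1 and l2 away from P, with n <= m, and let s be t if P is in S and t - 1
   otherwise. Every point of R has at least s tangents missing P; each of them
   joins a point of N to a point of M and is tangent at only one point, so
   |R| s <= n m.  For Q in S on l1, at least m - t of the lines from Q to M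
   contain a point of R, while from a given point of R at most m - s of the lines
   to M reach such a Q; hence (q - n) (m - t) <= |R| (m - s).  Together with the
   bound on q this forces m <= t, whereas t <= n because the tangents at a point
   of S on l2 meet l1 in N; so n = m = t.  If P is in S, then |R| <= t and the
   bound on q gives q > 2t; projecting from P the line joining two points of S on
   l1 and l2 gives q - 1 <= t + |R|, so q = 2t + 1 and |R| = t. *)

Require Import Defs.
From mathcomp Require Import all_boot all_order all_algebra.
From mathcomp Require Import zify lra.

Set Implicit Arguments.
Unset Strict Implicit.
Unset Printing Implicit Defensive.

(** The number of pairs related by [e] lies between the two products: count it by [a] for the lower
    bound, by [b] for the upper one. *)
Lemma leq_double_count (I J : finType) (A : {set I}) (B : {set J})
    (e : I -> J -> bool) (k c : nat) :
    (forall a, a \in A -> k <= #|[set b in B | e a b]|) ->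
    (forall b, b \in B -> #|[set a in A | e a b]| <= c) ->
  #|A| * k <= #|B| * c.
Proof.
move=> Ak Bc; rewrite -!sum_nat_const.
apply: (@leq_trans (\sum_(a in A) #|[set b in B | e a b]|)).
  exact: leq_sum.
apply: (@leq_trans (\sum_(b in B) #|[set a in A | e a b]|)); last exact: leq_sum.
under eq_bigr do rewrite -sum1dep_card big_mkcondr.
under [leqRHS]eq_bigr do rewrite -sum1dep_card big_mkcondr.
by rewrite exchange_big.
Qed.

(** * Joins, meets and tangents in a projective plane *)

Section Plane.
Variables (T : finType) (lines : {set {set T}}).
Hypothesis plane : projective_plane lines.
Implicit Types (P Q X Z : T) (l S : {set T}).

(** Meaningful for distinct points, where the default [set0] is never reached; for [P = Q] the pick
    is an arbitrary line through [P]. *)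
Definition join P Q : {set T} :=
  odflt set0 [pick l in lines | (P \in l) && (Q \in l)].

Lemma joinP P Q : P != Q ->
  [/\ join P Q \in lines, P \in join P Q & Q \in join P Q].
Proof.
case: plane => /(_ P Q) join1 _ _ /join1 [l [[lL Pl Ql] _]].
rewrite /join; case: pickP => [k /and3P[] //|/(_ l)].
by rewrite lL Pl Ql.
Qed.

Lemma join_uniq P Q l :
  P != Q -> l \in lines -> P \in l -> Q \in l -> join P Q = l.
Proof.
move=> nPQ lL Pl Ql; have [kL Pk Qk] := joinP nPQ.
case: plane => /(_ P Q nPQ) [g [_ g_uniq]] _ _.
by rewrite -(g_uniq l) // (g_uniq (join P Q)).
Qed.

Lemma line_uniq P Q l1 l2 : P != Q -> l1 \in lines -> l2 \in lines ->
  P \in l1 -> Q \in l1 -> P \in l2 -> Q \in l2 -> l1 = l2.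
Proof.
move=> nPQ l1L l2L Pl1 Ql1 Pl2 Ql2.
by rewrite -(join_uniq nPQ l1L Pl1 Ql1) (join_uniq nPQ l2L).
Qed.

Lemma meet_ex l1 l2 : l1 \in lines -> l2 \in lines -> l1 != l2 ->
  exists2 P, P \in l1 & P \in l2.
Proof.
case: plane => _ meet1 _ l1L l2L /(meet1 _ _ l1L l2L) [P [[Pl1 Pl2] _]].
by exists P.
Qed.

(** Two equal joins would share two points with [l], hence coincide with [l], which misses [P]. *)
Lemma join_inj P l : l \in lines -> P \notin l -> {in l &, injective (join P)}.
Proof.
move=> lL Pl Q Z Ql Zl eqj; apply/eqP; apply: contraNT (Pl) => nQZ.
have nPQ : P != Q by apply: contraNneq Pl => ->.
have nPZ : P != Z by apply: contraNneq Pl => ->.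
have [jL Pj Qj] := joinP nPQ; have [_ _ Zj] := joinP nPZ.
by rewrite (line_uniq nQZ lL jL) // eqj.
Qed.

Lemma tangentsP S P l : reflect
  [/\ l \in lines, P \in l, P \in S & forall Q, Q \in l -> Q \in S -> Q = P]
  (l \in tangents lines S P).
Proof.
rewrite inE; apply: (iffP andP) => [[lL /eqP lS]|[lL Pl PS l_tan]]; split=> //.
- by have := set11 P; rewrite -lS => /setIP[].
- by have := set11 P; rewrite -lS => /setIP[].
- by move=> Q Ql QS; apply/set1P; rewrite -lS inE Ql.
- apply/eqP/setP=> Q; rewrite !inE; apply/andP/eqP => [[]|->//]; exact: l_tan.
Qed.

(** * Points of two fixed lines, and the tangents that reach them *)

Definition arm S l1 l2 := (S :&: l1) :\: l2.
(** This is the set N of the overview; exchanging [l1] and [l2] gives M. *)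
Definition holes S l1 l2 := l1 :\: (S :|: l2).
Definition rest S l1 l2 := S :\: (l1 :|: l2).

Section TwoLines.
Variables (S l1 l2 : {set T}) (P : T).
Hypotheses (l1_line : l1 \in lines) (l2_line : l2 \in lines).
Hypothesis meet_l12 : l1 :&: l2 = [set P].

Lemma card_arm_holes q : #|l1| = q.+1 ->
  #|arm S l1 l2| + #|holes S l1 l2| = q.
Proof.
move=> l1q; have := cardsID l2 l1; rewrite meet_l12 cards1 l1q add1n => -[<-].
rewrite -(cardsID S (l1 :\: l2)); congr (_ + _); apply: eq_card => X;
  by rewrite !inE; case: (X \in l1); case: (X \in l2); case: (X \in S).
Qed.

(** A tangent at [Q] other than [l1] meets [l2] in a point different from [Q]; that point is outside
    [S] by tangency and off [l1], since it would otherwise force the tangent to be [l1]. *)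
Lemma tangents_arm Q : Q \in arm S l1 l2 ->
  tangents lines S Q \subset l1 |: join Q @: holes S l2 l1.
Proof.
rewrite !inE => /and3P[Ql2 QS Ql1]; apply/subsetP=> l /tangentsP[lL Ql _ l_tan].
rewrite in_setU1; have [//|nll1 /=] := eqVneq l l1.
have nll2 : l != l2 by apply: contraNneq Ql2 => <-.
have [Z Zl Zl2] := meet_ex lL l2_line nll2.
have nQZ : Q != Z by apply: contraNneq Ql2 => ->.
apply/imsetP; exists Z; last by rewrite (join_uniq nQZ lL).
rewrite !inE Zl2 andbT negb_or; apply/andP; split.
  by apply: contraNN nQZ => ZS; rewrite (l_tan Z).
by apply: contraNN nll1 => Zl1; rewrite (line_uniq nQZ lL l1_line).
Qed.

(** The extra unit allows for [l1] being itself tangent at [Q]. *)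
Lemma leq_tangents_arm Q : Q \in arm S l1 l2 ->
  #|tangents lines S Q| <= #|holes S l2 l1|.+1.
Proof.
move=> /tangents_arm /subset_leq_card /leq_trans; apply.
by rewrite cardsU1 -add1n leq_add ?leq_b1 ?leq_imset_card.
Qed.

(** A second point [Z] of [S] on [l1] keeps [l1] from being tangent. [Z] may be the common point of
    the two lines. *)
Lemma leq_tangents_secant_arm Q Z : Q \in arm S l1 l2 -> Z \in S -> Z \in l1 ->
  Z != Q -> #|tangents lines S Q| <= #|holes S l2 l1|.
Proof.
move=> QA ZS Zl1 nZQ; apply: leq_trans (leq_imset_card (join Q) _).
apply/subset_leq_card/subsetP=> l l_tan.
have /subsetP/(_ l l_tan) := tangents_arm QA.
rewrite in_setU1 => /predU1P[ll1|//]; move: l_tan; rewrite ll1.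
by case/tangentsP=> _ _ _ /(_ Z Zl1 ZS) eZQ; rewrite eZQ eqxx in nZQ.
Qed.

(** Missing [P], the tangent meets the two lines in distinct points; its only point in [S] is [X],
    which lies on neither line. *)
Lemma tangent_rest X l : X \in rest S l1 l2 -> l \in tangents lines S X ->
    P \notin l ->
  exists a b, [/\ a \in holes S l1 l2, b \in holes S l2 l1, a \in l & b \in l].
Proof.
move=> + /tangentsP[lL Xl _ l_tan] Pl.
rewrite !inE negb_or => /andP[/andP[Xl1 Xl2] XS].
have Pl1 : P \in l1 by have := set11 P; rewrite -meet_l12 => /setIP[].
have Pl2 : P \in l2 by have := set11 P; rewrite -meet_l12 => /setIP[].
have nll1 : l != l1 by apply: contraNneq Pl => ->.
have nll2 : l != l2 by apply: contraNneq Pl => ->.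
have [a al al1] := meet_ex lL l1_line nll1.
have [b bl bl2] := meet_ex lL l2_line nll2.
have off Z : Z \in l -> Z \in l1 -> Z \in l2 -> False.
  move=> Zl Zl1 Zl2; have : Z \in l1 :&: l2 by rewrite inE Zl1.
  by rewrite meet_l12 => /set1P eZP; rewrite -eZP Zl in Pl.
exists a, b; split=> //; rewrite !inE ?al1 ?bl2 andbT negb_or; apply/andP; split.
- by apply/negP=> /(l_tan a al) eaX; rewrite -eaX al1 in Xl1.
- by apply/negP=> /(off a al al1).
- by apply/negP=> /(l_tan b bl) ebX; rewrite -ebX bl2 in Xl2.
- by apply/negP=> bl1; apply: off bl2.
Qed.

(** * Two double counts based on tangents that avoid [P] *)

Section FreeTangents.
Variable s : nat.
Hypothesis free_tangents : forall X, X \in rest S l1 l2 ->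
  s <= #|[set l in tangents lines S X | P \notin l]|.

Lemma leq_rest_holes :
  #|rest S l1 l2| * s <= #|holes S l1 l2| * #|holes S l2 l1|.
Proof.
rewrite -cardsX -[leqRHS]muln1.
pose e X (ab : T * T) := join ab.1 ab.2 \in tangents lines S X.
apply: (leq_double_count (e := e)) => [X XR|[a b] _].
  apply: leq_trans (free_tangents XR) _.
  apply: leq_trans (leq_imset_card (fun ab : T * T => join ab.1 ab.2) _).
  apply/subset_leq_card/subsetP=> l; rewrite inE => /andP[l_tan Pl].
  have [a [b [aN bM al bl]]] := tangent_rest XR l_tan Pl.
  have nab : a != b.
    move: aN bM; rewrite !inE negb_or => /andP[/andP[_ al2] _] /andP[_ bl2].
    by apply: contraNneq al2 => ->.
  have lL : l \in lines by case/tangentsP: l_tan.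
  apply/imsetP; exists (a, b); last by rewrite /= (join_uniq nab lL).
  by rewrite inE in_setX aN bM /e /= (join_uniq nab lL).
(* A pair of holes determines its join, and a line is tangent at no more than one point. *)
apply/card_le1_eqP => Y X /setIdP[_ /tangentsP[_ _ _ Y_tan]].
by case/setIdP=> _ /tangentsP[_ Xl XS _]; apply: Y_tan.
Qed.

(** Subtraction is truncated: the left side vanishes when M has at most [t] points, so the bound has
    content only beyond [t]. *)
Lemma leq_arm_rest t : (forall Q, Q \in S -> #|tangents lines S Q| = t) ->
  #|arm S l1 l2| * (#|holes S l2 l1| - t) <=
  #|rest S l1 l2| * (#|holes S l2 l1| - s).
Proof.
move=> S_tan; set M := holes S l2 l1.
have Ml2 : M \subset l2 by apply/subsetP=> X; rewrite !inE => /andP[].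
have Minj X : X \notin l2 -> {in M &, injective (join X)}.
  by move=> Xl2; apply: sub_in2 (join_inj l2_line Xl2); apply/subsetP.
(* Double counting of the pairs (Q, X) whose join passes through a hole of l2. *)
pose e Q X := [exists a in M, a \in join Q X].
apply: (leq_double_count (e := e)) => [Q QA|X XR].
  have [QS Ql1 Ql2] : [/\ Q \in S, Q \in l1 & Q \notin l2].
    by move: QA; rewrite !inE => /and3P[].
  (* The joins of [Q] with M are distinct lines; each is one of the [t] tangents at [Q] or passes
     through a point of [rest]. *)
  rewrite leq_subLR -(S_tan Q QS) -(card_in_imset (Minj Q Ql2)).
  apply: leq_trans (leq_add (leqnn _) (leq_imset_card (join Q) _)).
  apply: leq_trans (leq_card_setU _ _).
  apply/subset_leq_card/subsetP=> _ /imsetP[a aM ->].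
  have [al2 aS al1] : [/\ a \in l2, a \notin S & a \notin l1].
    by move: aM; rewrite !inE negb_or => /andP[/andP[]].
  have nQa : Q != a by apply: contraNneq al1 => <-.
  have [jL Qj aj] := joinP nQa.
  rewrite in_setU; have [//|/= ntan] := boolP (join Q a \in tangents _ _ _).
  have [X Xj /andP[XS nXQ]] : exists2 X, X \in join Q a & (X \in S) && (X != Q).
    apply/exists_inP; apply: contraNT ntan => /exists_inPn nX.
    apply/tangentsP; split=> // X Xj XS.
    by apply/eqP; have := nX X Xj; rewrite XS /= negbK.
  have nXa : X != a by apply: contraNneq aS => <-.
  have eQX : join Q X = join Q a by apply: join_uniq; rewrite 1?eq_sym.
  apply/imsetP; exists X => //; rewrite !inE XS andbT negb_or -andbA.
  apply/and3P; split.
  - by apply: contraNN al1 => Xl1; rewrite -(line_uniq nXQ jL l1_line).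
  - by apply: contraNN Ql2 => Xl2; rewrite -(line_uniq nXa jL l2_line).
  - by apply/exists_inP; exists a; rewrite ?eQX.
have [XS Xl1 Xl2] : [/\ X \in S, X \notin l1 & X \notin l2].
  by move: XR; rewrite !inE negb_or => /andP[/andP[]].
(* The lines of [F] and the joins of [X] with [B] are disjoint families of lines through [X], all
   meeting M; hence their total is at most [#|M|]. *)
set B := [set _ in _ | _]; pose F := [set l in tangents lines S X | P \notin l].
have BP Q : Q \in B -> [/\ Q != X, Q \in S, Q \in l1 &
    exists2 a, a \in M & a \in join Q X].
  rewrite !inE => /andP[/and3P[Ql2 QS Ql1] /exists_inP Qa]; split=> //.
  by apply: contraNneq Xl1 => <-.
have Binj : {in B &, injective (join X)}.
  by apply: sub_in2 (join_inj l1_line Xl1) => Q /BP[].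
have FB : [disjoint F & join X @: B].
  apply/pred0P=> l; apply/negP=> /= /andP[]; rewrite inE => /andP[l_tan _].
  case/imsetP=> Q /BP[nQX QS _ _] el; move: l_tan; rewrite el.
  have [|_ _ Qj] := @joinP X Q; first by rewrite eq_sym.
  by case/tangentsP=> _ _ _ /(_ Q Qj QS) /eqP; rewrite (negbTE nQX).
suff: #|F| + #|B| <= #|M| by have := free_tangents XR; rewrite -/F; lia.
rewrite -(card_in_imset Binj) -(card_in_imset (Minj X Xl2)).
move: FB; rewrite -leq_card_setU => /eqP <-.
apply/subset_leq_card; rewrite subUset; apply/andP; split; apply/subsetP.
  move=> l; rewrite inE => /andP[l_tan Pl].
  have [_ [a [_ aM _ al]]] := tangent_rest XR l_tan Pl.
  have /tangentsP[lL Xl _ _] := l_tan.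
  apply/imsetP; exists a => //; rewrite (join_uniq _ lL) //.
  by apply: contraNneq Xl2 => ->; move: aM; rewrite inE => /andP[].
move=> _ /imsetP[Q /BP[nQX _ _ [a aM aj]] ->].
have nXa : X != a by apply: contraNneq Xl2 => ->; apply: (subsetP Ml2).
have [jL Qj Xj] := joinP nQX.
apply/imsetP; exists a => //.
by rewrite (join_uniq nXa jL) // (join_uniq _ jL) // eq_sym.
Qed.

End FreeTangents.

(** The line [join Q Z] misses [P], so its [q.-1] other points give distinct lines through [P],
    different from [l1] and [l2]. Each is tangent at [P] or has a further point of [S], which then
    lies in [rest]. *)
Lemma leq_pencil q Q Z : (forall l, l \in lines -> #|l| = q.+1) -> P \in S ->
    Q \in arm S l1 l2 -> Z \in arm S l2 l1 ->
  q.-1 <= #|tangents lines S P| + #|rest S l1 l2|.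
Proof.
move=> lq PS; rewrite !inE => /and3P[Ql2 QS Ql1] /and3P[Zl1 ZS Zl2].
have Pl1 : P \in l1 by have := set11 P; rewrite -meet_l12 => /setIP[].
have Pl2 : P \in l2 by have := set11 P; rewrite -meet_l12 => /setIP[].
have nQZ : Q != Z by apply: contraNneq Zl1 => <-.
have nPQ : P != Q by apply: contraNneq Ql2 => <-.
have nPZ : P != Z by apply: contraNneq Zl1 => <-.
have [] := joinP nQZ; set l := join Q Z => lL Ql Zl.
have Pl : P \notin l.
  by apply: contraNN Zl1 => Pl; rewrite -(line_uniq nPQ lL l1_line).
have -> : q.-1 = #|l :\ Q :\ Z|.
  have := cardsD1 Q l; have := cardsD1 Z (l :\ Q); rewrite (lq l lL) Ql !inE Zl.
  by rewrite eq_sym nQZ !add1n => -> [->].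
have inj : {in l :\ Q :\ Z &, injective (join P)}.
  by apply: sub_in2 (join_inj lL Pl) => X; rewrite !inE => /and3P[].
rewrite -(card_in_imset inj).
apply: leq_trans (leq_add (leqnn _) (leq_imset_card (join P) _)).
apply: leq_trans (leq_card_setU _ _).
apply/subset_leq_card/subsetP=> _ /imsetP[Y + ->].
rewrite !inE => /and3P[nYZ nYQ Yl].
have nPY : P != Y by apply: contraNneq Pl => ->.
have [] := joinP nPY; set g := join P Y => gL Pg Yg.
have ngl1 : g != l1.
  apply: contraNneq Pl => gl1.
  by rewrite -(line_uniq nYQ l1_line lL) // -gl1.
have ngl2 : g != l2.
  apply: contraNneq Pl => gl2.
  by rewrite -(line_uniq nYZ l2_line lL) // -gl2.
have [|/= ntan] := boolP (g \in tangents lines S P); first by rewrite inE => ->.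
have [X Xg /andP[XS nXP]] : exists2 X, X \in g & (X \in S) && (X != P).
  apply/exists_inP; apply: contraNT ntan => /exists_inPn nX.
  apply/tangentsP; split=> // X Xg XS.
  by apply/eqP; have := nX X Xg; rewrite XS /= negbK.
apply/orP; right; apply/imsetP; exists X; last first.
  by rewrite (join_uniq _ gL) // eq_sym.
rewrite !inE XS andbT negb_or; apply/andP; split.
  by apply: contraNN ngl1 => Xl1; rewrite (line_uniq nXP gL l1_line).
by apply: contraNN ngl2 => Xl2; rewrite (line_uniq nXP gL l2_line).
Qed.

Lemma card_arms : P \in S ->
  #|S| = (#|arm S l1 l2| + #|arm S l2 l1| + #|rest S l1 l2|).+1.
Proof.
move=> PS; rewrite -(cardsID (l1 :|: l2) S) -/(rest S l1 l2).
rewrite -(cardsID l2 (S :&: _)) -(cardsID l1 (S :&: _ :&: l2)).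
have -> : S :&: (l1 :|: l2) :&: l2 :&: l1 = S :&: (l1 :&: l2).
  by apply/setP=> X; rewrite !inE; case: (X \in l1); case: (X \in l2); rewrite ?andbT ?andbF.
rewrite meet_l12 (setIidPr _) ?sub1set // cards1.
have -> : S :&: (l1 :|: l2) :&: l2 :\: l1 = arm S l2 l1.
  by apply/setP=> X; rewrite !inE; case: (X \in l1); case: (X \in l2); rewrite ?andbT ?andbF.
have -> : (S :&: (l1 :|: l2)) :\: l2 = arm S l1 l2.
  by apply/setP=> X; rewrite !inE; case: (X \in l1); case: (X \in l2); rewrite ?andbT ?andbF.
by rewrite add1n !addSn [#|arm S l2 l1| + _]addnC.
Qed.

Lemma V_configuration_holes t :
    #|holes S l1 l2| = t -> #|holes S l2 l1| = t ->
  V_configuration t l1 l2 (symdiff l1 l2 :&: S).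
Proof.
move=> h1 h2; exists (holes S l1 l2), (holes S l2 l1); split=> //.
- by apply/subsetP=> X; rewrite !inE negb_or => /andP[/andP[_ ->] ->].
- by apply/subsetP=> X; rewrite !inE negb_or => /andP[/andP[_ ->] ->].
- by apply/setP=> X; rewrite !inE; case: (X \in l1); case: (X \in l2); case: (X \in S).
Qed.

End TwoLines.

(** * The arithmetic of the two cases *)

Section Bounds.
Variables (S l1 l2 : {set T}) (P : T).
Hypotheses (l1_line : l1 \in lines) (l2_line : l2 \in lines).
Hypothesis meet_l12 : l1 :&: l2 = [set P].
Variables (q t : nat).
Hypothesis line_card : forall l, l \in lines -> #|l| = q.+1.
Hypothesis t_ltq : t < q.
Hypothesis S_tan : forall Q, Q \in S -> #|tangents lines S Q| = t.
Notation n := #|holes S l1 l2|.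
Notation m := #|holes S l2 l1|.
Hypothesis le_nm : n <= m.

(** The last hypothesis is the rational bound with minimum [n], multiplied by [t - 1]. *)
Lemma holes_circ : P \notin S -> 1 < t -> t.-1 * n + 2 * n * m < t.-1 * q ->
  n = t /\ m = t.
Proof.
move=> PS t_gt1 small.
have a1D : #|arm S l1 l2| + n = q.
  exact: (card_arm_holes S meet_l12 (line_card l1_line)).
have a2D : #|arm S l2 l1| + m = q.
  by apply: (card_arm_holes S _ (line_card l2_line)); rewrite setIC; exact: meet_l12.
have free X : X \in rest S l1 l2 ->
    t.-1 <= #|[set l in tangents lines S X | P \notin l]|.
  move=> XR; have [XS nXP] : X \in S /\ X != P.
    have XS : X \in S by move: XR; rewrite inE => /andP[].
    by split=> //; apply: contraNneq PS => <-.
  rewrite -(S_tan XS) -(cardsID [set l : {set T} | P \in l] (tangents lines S X)).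
  set A := _ :&: _; set B := _ :\: _; set C := [set _ in _ | _].
  have -> : C = B by apply/setP=> l; rewrite !inE andbC.
  (* The only possible tangent at [X] through [P] is [join X P]. *)
  suff : #|A| <= 1 by case: #|A| => [|[|//]] _; rewrite ?add1n ?add0n ?leq_pred.
  rewrite -(cards1 (join X P)); apply/subset_leq_card/subsetP=> l.
  case/setIP=> /tangentsP[lL Xl _ _]; rewrite inE => Pl.
  by rewrite in_set1 (join_uniq nXP lL).
have rD := leq_rest_holes l1_line l2_line meet_l12 free.
have aD := leq_arm_rest l1_line l2_line meet_l12 free S_tan.
have a1_gt : 2 * n * m < t.-1 * #|arm S l1 l2| by move: small; rewrite -a1D mulnDr; lia.
have le_mt : m <= t.
  rewrite leqNgt; apply/negP=> lt_tm.
  (* The factor 2 comes from [m - t.-1 = (m - t) + 1 <= 2 * (m - t)], valid as [t < m]. *)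
  have : #|arm S l1 l2| * (m - t) <= 2 * #|rest S l1 l2| * (m - t).
    apply: leq_trans aD _; rewrite -mulnA mulnCA leq_mul2l; apply/orP; right; lia.
  rewrite leq_pmul2r ?subn_gt0 // => le_a1r.
  have := leq_mul (leqnn t.-1) le_a1r; rewrite mulnCA [t.-1 * #|rest _ _ _|]mulnC.
  by lia.
have [Z ZA] : exists Z, Z \in arm S l2 l1 by apply/card_gt0P; lia.
have [ZS Zl2] : Z \in S /\ Z \in l2 by move: ZA; rewrite !inE => /and3P[].
have le_tn1 : t <= n.+1.
  by rewrite -(S_tan ZS); apply: (leq_tangents_arm l2_line l1_line ZA).
suff : t <= n by lia.
(* If l2 contains a second point of S, it is not itself a tangent. *)
have [a2_le1|] := leqP #|arm S l2 l1| 1; last first.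
  case/card_gt1P=> X [Y [XA YA nXY]].
  have XS : X \in S by move: XA; rewrite !inE => /and3P[].
  have [YS Yl2] : Y \in S /\ Y \in l2 by move: YA; rewrite !inE => /and3P[].
  by rewrite -(S_tan XS); apply: (leq_tangents_secant_arm l2_line l1_line XA YS Yl2);
    rewrite eq_sym.
(* With one point in the second arm, [m <= t < q] forces [m = t] and [q = t + 1], and [n = t - 1]
   leaves two points in the first. Then [a1_gt] reads [2 * (t - 1) * t < 2 * (t - 1)]. *)
rewrite leqNgt; apply/negP=> lt_nt; move: a1_gt.
have [-> -> ->] : [/\ #|arm S l1 l2| = 2, n = t.-1 & m = t] by split; lia.
by nia.
Qed.

Lemma holes_bullet : P \in S -> 0 < t -> t * n + n * m < t * q ->
  [/\ n = t, m = t, q = t.*2.+1 & #|S| = 3 * t.+1].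
Proof.
move=> PS t_gt0 small.
have Pl1 : P \in l1 by have := set11 P; rewrite -meet_l12 => /setIP[].
have Pl2 : P \in l2 by have := set11 P; rewrite -meet_l12 => /setIP[].
have a1D : #|arm S l1 l2| + n = q.
  exact: (card_arm_holes S meet_l12 (line_card l1_line)).
have a2D : #|arm S l2 l1| + m = q.
  by apply: (card_arm_holes S _ (line_card l2_line)); rewrite setIC; exact: meet_l12.
have free X : X \in rest S l1 l2 ->
    t <= #|[set l in tangents lines S X | P \notin l]|.
  rewrite !inE negb_or => /andP[/andP[Xl1 _] XS]; rewrite -(S_tan XS).
  apply/subset_leq_card/subsetP=> l l_tan; rewrite inE l_tan /=.
  case/tangentsP: l_tan => _ _ _ l_tan; apply/negP=> /l_tan/(_ PS) ePX.
  by rewrite -ePX Pl1 in Xl1.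
have rD := leq_rest_holes l1_line l2_line meet_l12 free.
have aD := leq_arm_rest l1_line l2_line meet_l12 free S_tan.
have a1_gt : n * m < t * #|arm S l1 l2| by move: small; rewrite -a1D mulnDr; lia.
have le_mt : m <= t.
  (* Here [s = t], so the positive factor [m - t] cancels: the arm is no larger than [rest], against
     [rD] and [a1_gt]. *)
  rewrite leqNgt; apply/negP=> lt_tm; move: aD.
  rewrite leq_pmul2r ?subn_gt0 // => le_a1r.
  by have := leq_mul (leqnn t) le_a1r; rewrite [t * #|rest _ _ _|]mulnC; lia.
have [Z ZA] : exists Z, Z \in arm S l2 l1 by apply/card_gt0P; lia.
have [Q QA] : exists Q, Q \in arm S l1 l2 by apply/card_gt0P; lia.
have ZS : Z \in S by move: ZA; rewrite !inE => /and3P[].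
have nPZ : P != Z by apply: contraTneq ZA => <-; rewrite !inE Pl1.
have le_tn : t <= n.
  by rewrite -(S_tan ZS); apply: (leq_tangents_secant_arm l2_line l1_line ZA PS Pl2 nPZ).
have nt : n = t by apply/eqP; rewrite eqn_leq le_tn (leq_trans le_nm).
have mt : m = t by apply/eqP; rewrite eqn_leq le_mt (leq_trans le_tn).
have le_rt : #|rest S l1 l2| <= t by move: rD; rewrite nt mt leq_pmul2r.
have := leq_pencil l1_line l2_line meet_l12 line_card PS QA ZA; rewrite (S_tan PS) => le_qr.
have lt_2tq : t.*2 < q.
  by move: small; rewrite nt mt -mulnDr addnn ltn_pmul2l.
have qt : q = t.*2.+1 by lia.
(* Each arm has [q - t = t + 1] points, [rest] has exactly [t], and [P] adds one. *)
by split=> //; rewrite (card_arms meet_l12) //; lia.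
Qed.

End Bounds.

End Plane.

(** * Passage from rational inequalities to natural numbers *)

Import Order.TTheory GRing.Theory Num.Theory.
Local Open Scope ring_scope.

Theorem theorem3p6 (q : nat) (T : finType) (lines : {set {set T}})
    (plane : projective_plane_of_order q lines)
    (t : nat) (t_ge1 : (1 <= t)%N) (t_ltq : (t < q)%N)
    (S : {set T}) (S_semiarc : semiarc lines t S)
    (l1 l2 : {set T}) (l1_line : l1 \in lines) (l2_line : l2 \in lines)
    (l12 : l1 != l2)
    (P : T) (meet_l12 : l1 :&: l2 = [set P])
    (n m : nat)
    (n_def : n = #|l1 :\: (S :|: l2)|) (m_def : m = #|l2 :\: (S :|: l1)|) :
  (P \notin S -> (1 < t)%N ->
     (minn n m)%:R + 2 * n%:R * m%:R / (t%:R - 1) < q%:R :> rat ->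
     [/\ n = t, m = t & V_circ_type lines t S])
  /\
  (P \in S ->
     (minn n m)%:R + n%:R * m%:R / t%:R < q%:R :> rat ->
     [/\ n = t, m = t, t%:R = (q%:R - 1) / 2 :> rat,
         #|S|%:R = 3 * (q%:R + 1) / 2 :> rat & V_bullet_type lines t S]).
Proof.
subst n m; rewrite -/(holes S l1 l2) -/(holes S l2 l1).
set n := #|holes S l1 l2|; set m := #|holes S l2 l1|.
case: plane => plane0 line_card; case: S_semiarc => _ S_tan.
have meet_l21 : l2 :&: l1 = [set P] by rewrite setIC.
split=> [PS t_gt1 | PS] small.
- have {}small : (t.-1 * minn n m + 2 * n * m < t.-1 * q)%N.
    have t1 : t%:R - 1 = t.-1%:R :> rat by rewrite -subn1 natrB.
    have t1_gt0 : 0 < t.-1%:R :> rat by rewrite ltr0n; lia.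
    move: small; rewrite t1 -(ltr_pM2l t1_gt0) mulrDr mulrCA divff ?gt_eqF //.
    by rewrite mulr1 -!natrM -natrD ltr_nat.
  suff [nt mt] : n = t /\ m = t.
    split=> //; exists l1, l2; split=> //; last by exists P.
    exact: V_configuration_holes.
  (* The bounds were proved for [n <= m]; otherwise the two lines are exchanged. *)
  have [le_nm|/ltnW le_mn] := leqP n m.
    rewrite (minn_idPl le_nm) in small.
    exact: (holes_circ plane0 l1_line l2_line meet_l12 line_card).
  rewrite (minn_idPr le_mn) mulnAC in small; apply/and_comm.
  exact: (holes_circ plane0 l2_line l1_line meet_l21 line_card).
- have {}small : (t * minn n m + n * m < t * q)%N.
    have t_gt0 : 0 < t%:R :> rat by rewrite ltr0n.
    move: small; rewrite -(ltr_pM2l t_gt0) mulrDr mulrCA divff ?gt_eqF //.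
    by rewrite mulr1 -!natrM -natrD ltr_nat.
  suff [nt mt qt St] : [/\ n = t, m = t, q = t.*2.+1 & #|S| = 3 * t.+1]%N.
    have qE : q%:R = t%:R * 2 + 1 :> rat by rewrite -natrM natr1 muln2 qt.
    have SE : #|S|%:R = 3 * (t%:R + 1) :> rat by rewrite natr1 -natrM St.
    split=> //.
    + by rewrite qE; lra.
    + by rewrite SE qE; lra.
    + exists l1, l2; split=> //; last by exists P.
      exact: V_configuration_holes.
  have [le_nm|/ltnW le_mn] := leqP n m.
    rewrite (minn_idPl le_nm) in small.
    exact: (holes_bullet plane0 l1_line l2_line meet_l12 line_card).
  rewrite (minn_idPr le_mn) [(n * m)%N]mulnC in small.
  by case: (holes_bullet plane0 l2_line l1_line meet_l21 line_card t_ltq S_tan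
              le_mn PS t_ge1 small).
Qed.
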